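(* Let $H$ be a complex Hilbert space and let $M_0,M_1\in L(H)$ be such that $R(M_0)$ is closed and the linear operator pencil $\mathcal{M}$ associated with $(M_0,M_1)$ is regular. Let $u_0\in H$. If $u:\mathbb{R}_{\ge0}\to H$ is continuous, $u|_{\mathbb{R}_{>0}}$ is continuously differentiable, and $u$ satisfies $$M_0u'(t)+M_1u(t)=0\quad(t>0),\qquad u(0)=u_0,$$ then $$u_0\in\mathrm{IV}:=\{x\in H: M_1x\in R(M_0)\}=M_1^{-1}[R(M_0)].$$
   Context: $L(H)$ is the space of bounded linear operators on $H$; $R(M_0)$ denotes the range of $M_0$, and $M_1^{-1}[\cdot]$ denotes the preimage under $M_1$. The linear operator pencil associated with $(M_0,M_1)$ is $\mathcal{M}:\mathbb{C}\to L(H)$, $\mathcal{M}(z)=zM_0+M_1$. It is called regular (of index $0$) if there is $\nu\in\mathbb{R}$ such that $zM_0+M_1$ is boundedly invertible for all $z$ with $\operatorname{Re}z>\nu$ and $z\mapsto(zM_0+M_1)^{-1}\in L(H)$ is bounded on $\{z\in\mathbb{C}:\operatorname{Re}z>\nu\}$. *)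

(* Defs.v *)
From HB Require Import structures.
From mathcomp Require Import all_boot all_order all_algebra.
From mathcomp Require Import sesquilinear.
From mathcomp Require Import complex.
From mathcomp Require Import all_classical all_reals all_analysis.

Set Implicit Arguments.
Unset Strict Implicit.
Unset Printing Implicit Defensive.

Import Order.TTheory GRing.Theory Num.Theory.
Import numFieldNormedType.Exports.

Local Open Scope classical_set_scope.
Local Open Scope ring_scope.
Local Open Scope complex_scope.

(* The norm of a normed module over R[i] takes its values in R[i] (they are
   real and nonnegative there); hence the injection _%:C of real constants and
   the projection complex.Re below. *)

(* A complex Hilbert space is a complete normed space over R[i] together with
   a positive definite Hermitian form inducing its norm. *)
Definition induces_norm (R : realType) (H : normedModType R[i])
    (dot : {dot H for Num.conj}) : Prop :=
  forall x : H, `|x| ^+ 2 = dot x x.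

(* L(H) is the set of the T : {linear H -> H} satisfying bounded_operator. *)
Definition bounded_operator (R : realType) (H : normedModType R[i])
    (T : {linear H -> H}) : Prop :=
  exists c : R, forall x : H, `|T x| <= c%:C * `|x|.

(* Meaningful only for bounded operators: otherwise the sup is unspecified. *)
Definition op_norm (R : realType) (H : normedModType R[i])
    (T : {linear H -> H}) : R :=
  sup [set complex.Re `|T x| | x in [set x : H | `|x| <= 1]].

Definition pencil (R : realType) (H : normedModType R[i])
    (M0 M1 : {linear H -> H}) (z : R[i]) : {linear H -> H} :=
  z \*: M0 \+ M1.

Definition bounded_inverse (R : realType) (H : normedModType R[i])
    (T S : {linear H -> H}) : Prop :=
  [/\ bounded_operator S, cancel T S & cancel S T].

Definition boundedly_invertible (R : realType) (H : normedModType R[i])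
    (T : {linear H -> H}) : Prop :=
  exists S : {linear H -> H}, bounded_inverse T S.

(* The inverse being unique, the second clause says that the map sending z to
   the inverse of pencil M0 M1 z is bounded on the half-plane. *)
Definition regular_pencil (R : realType) (H : normedModType R[i])
    (M0 M1 : {linear H -> H}) : Prop :=
  exists nu : R,
    (forall z : R[i], nu < complex.Re z ->
       boundedly_invertible (pencil M0 M1 z)) /\
    (exists K : R, forall (z : R[i]) (S : {linear H -> H}),
       nu < complex.Re z -> bounded_inverse (pencil M0 M1 z) S ->
       op_norm S <= K).

(* The library's derivable and derive need the domain and the codomain to be
   normed modules over the same field; here the domain is R and the codomain
   is a space over R[i]. *)
Definition diff_quotient (R : realType) (H : normedModType R[i])
    (u : R -> H) (t h : R) : H :=
  (h^-1)%:C *: (u (t + h) - u t).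

Definition rderivable (R : realType) (H : normedModType R[i])
    (u : R -> H) (t : R) : Prop :=
  cvg (diff_quotient u t h @[h --> 0^']).

Definition rderive (R : realType) (H : normedModType R[i])
    (u : R -> H) (t : R) : H :=
  lim (diff_quotient u t h @[h --> 0^']).

Definition continuously_differentiable_on (R : realType)
    (H : normedModType R[i]) (A : set R) (u : R -> H) : Prop :=
  (forall t : R, A t -> rderivable u t) /\ {within A, continuous (rderive u)}.

Definition IV (R : realType) (H : normedModType R[i])
    (M0 M1 : {linear H -> H}) : set H :=
  [set x | range M0 (M1 x)].

(* Main.v *)
Require Import Defs.
From HB Require Import structures.
From mathcomp Require Import all_boot all_order all_algebra.
From mathcomp Require Import sesquilinear.
From mathcomp Require Import complex.
From mathcomp Require Import all_classical all_reals all_analysis.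

Set Implicit Arguments.
Unset Strict Implicit.
Unset Printing Implicit Defensive.

Import Order.TTheory GRing.Theory Num.Theory.
Import numFieldNormedType.Exports.

Local Open Scope classical_set_scope.
Local Open Scope ring_scope.

(** For t > 0 the equation reads M1 (u t) = M0 (- u' t), so M1 (u t) lies in the
    range of M0. As t decreases to 0, u t tends to u0, hence M1 (u t) tends to
    M1 u0 by boundedness of M1; the range of M0 being closed, the limit M1 u0
    lies in it as well (closed_preimage_right_limit). *)

Lemma bounded_operator_continuous (R : realType) (H : normedModType R[i])
    (T : {linear H -> H}) : bounded_operator T -> continuous T.
Proof.
move=> [c Tc]; apply/linear_bounded_continuous/linear_boundedP.
(* The order on R[i] is partial and a neighbourhood of +oo must contain all
   points above some real one; hence the threshold is the real constant c. *)
exists (real_complex R c); split => [|r cr x].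
  by rewrite complex_real.
exact: le_trans (Tc x) (ler_wpM2r (normr_ge0 x) (ltW cr)).
Qed.

(** Continuity on the closed half-line is stated with the trace of nbhs 0 on it;
    the right filter 0^'+ is finer, and, unlike that trace, it discards 0, where
    membership in C is the very thing to be proved. *)
Lemma closed_preimage_right_limit (R : realType) (X Y : topologicalType)
    (u : R -> X) (f : X -> Y) (C : set Y) :
  {within [set t : R | 0 <= t], continuous u} -> continuous f -> closed C ->
  (forall t, 0 < t -> C (f (u t))) -> C (f (u 0)).
Proof.
move=> /subspace_continuousP uc fc Ccl Cfu.
have u0 : u t @[t --> 0^'+] --> u 0.
  apply: cvg_trans (uc 0 (lexx 0)).
  by apply: cvg_app; apply: within_subset => t /= /ltW.
apply: (closed_cvg (u_ := f \o u) C Ccl _ _ (cvg_comp _ _ u0 (fc (u 0)))).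
by near=> t; apply: Cfu; near: t; exact: nbhs_right_gt.
Unshelve. all: by end_near. Qed.

Theorem lemma4p1 (R : realType) (H : completeNormedModType R[i])
  (dot : {dot H for Num.conj}) (hdot : induces_norm dot)
  (M0 M1 : {linear H -> H})
  (hM0 : bounded_operator M0) (hM1 : bounded_operator M1)
  (hclosed : closed (range M0))
  (hreg : regular_pencil M0 M1)
  (u0 : H) (u : R -> H)
  (hcont : {within [set t : R | 0 <= t], continuous u})
  (hdiff : continuously_differentiable_on [set t : R | 0 < t] u)
  (heq : forall t : R, 0 < t -> M0 (rderive u t) + M1 (u t) = 0)
  (hinit : u 0 = u0) :
  IV M0 M1 u0 /\ IV M0 M1 = M1 @^-1` range M0.
Proof.
split=> //; rewrite /IV /= -hinit.
apply: (closed_preimage_right_limit hcont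
  (bounded_operator_continuous hM1) hclosed) => t t0.
exists (- rderive u t) => //.
by apply/eqP; rewrite linearN eq_sym -addr_eq0 addrC heq.
Qed.
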